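(* Let $Q$ be a finite solvable extra loop and $\pi$ a set of primes. Then: (1) $Q$ has a Hall $\pi$-subloop. (2) If $P_1, P_2 \in \mathrm{Hall}_\pi(Q)$, then there exists $x \in Q$ such that $P_1 T_x = P_2$. (3) Any $\pi$-subloop of $Q$ is contained in some Hall $\pi$-subloop of $Q$.
   Context: A loop is a set with a binary operation having a two-sided identity $1$ and such that for all $a,b$ the equations $ax=b$ and $ya=b$ have unique solutions. In products, juxtaposition binds more tightly than $\cdot$. An extra loop is a loop that is both conjugacy closed and Moufang; equivalently (and this may be taken as the definition) a loop satisfying the identity $(xy\cdot z)\cdot x = x\cdot(y\cdot zx)$. A normal subloop is the kernel of a loop homomorphism. A loop $Q$ is solvable if there is a normal series $1=Q_0\trianglelefteq Q_1\trianglelefteq\cdots\trianglelefteq Q_m=Q$ of subloops such that each factor $Q_{i+1}/Q_i$ is an abelian group. Maps are written on the right: $xy = xR_y = yL_x$ defines the translations $R_y, L_x$, and $T_x := R_x L_x^{-1}$ (apply $R_x$ first), so $yT_x$ is the unique $w$ with $xw = yx$. For a set of primes $\pi$, a finite loop is a $\pi$-loop if every prime factor of its order lies in $\pi$; a $\pi$-subloop is a subloop that is a $\pi$-loop. If $|Q|=\prod_p p^{i_p}$ is the prime factorization, a Hall $\pi$-subloop of $Q$ is a subloop of order $\prod_{p\in\pi}p^{i_p}$, and $\mathrm{Hall}_\pi(Q)$ is the set of all Hall $\pi$-subloops of $Q$. *)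

(* Defs.v *)
From HB Require Import structures.
From mathcomp Require Import all_boot all_fingroup.

Set Implicit Arguments.
Unset Strict Implicit.
Unset Printing Implicit Defensive.

Declare Scope loop_scope.
Delimit Scope loop_scope with loop.

HB.mixin Record isLoop G := {
  lone : G;
  lmul : G -> G -> G;
  lmul1l : left_id lone lmul;
  lmull1 : right_id lone lmul;
  loop_ldiv : forall a b : G, exists! x, lmul a x = b;
  loop_rdiv : forall a b : G, exists! y, lmul y a = b
}.

#[short(type="loopType")]
HB.structure Definition Loop := {G of isLoop G}.
Bind Scope loop_scope with Loop.sort.

#[short(type="finLoopType")]
HB.structure Definition FinLoop := {G of isLoop G & Finite G}.
Bind Scope loop_scope with FinLoop.sort.

Notation "1" := (@lone _) : loop_scope.
Notation "x * y" := (lmul x y) : loop_scope.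

Local Open Scope loop_scope.

Definition extra_loop (Q : loopType) : Prop :=
  forall x y z : Q, ((x * y) * z) * x = x * (y * (z * x)).

Section LoopTheory.

Variable Q : loopType.

Lemma loop_mulI (a : Q) : injective (fun y => a * y).
Proof.
by move=> x y /= eq_ax; have [z [_ uz]] := loop_ldiv a (a * y);
  rewrite -(uz x eq_ax) (uz y erefl).
Qed.

Lemma loop_Imul (a : Q) : injective (fun y => y * a).
Proof.
by move=> x y /= eq_xa; have [z [_ uz]] := loop_rdiv a (y * a);
  rewrite -(uz x eq_xa) (uz y erefl).
Qed.

End LoopTheory.

Section FinLoopDefs.

Variable Q : finLoopType.
Implicit Types (x y : Q) (H N P : {set Q}).

Definition Ltr x : {perm Q} := perm (@loop_mulI Q x).
Definition Rtr x : {perm Q} := perm (@loop_Imul Q x).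

(* Permutations are composed from left to right: Rtr x is applied first. *)
Definition Tmap x : {perm Q} := (Rtr x * (Ltr x)^-1)%g.

Lemma TmapP x y : x * Tmap x y = y * x.
Proof.
have := permKV (Ltr x) (Rtr x y).
by rewrite [Ltr x _]permE [Rtr x y]permE /Tmap permM [Rtr x y]permE.
Qed.

(* Closure under the operation and under both divisions, where *)
(* (Ltr x)^-1 y = x \ y and (Rtr x)^-1 y = y / x. *)
Definition subloop H : bool :=
  (1 \in H) && [forall x in H, forall y in H,
    [&& x * y \in H, (Ltr x)^-1%g y \in H & (Rtr x)^-1%g y \in H]].

(* A homomorphism from the subloop H is a map on Q of which only the *)
(* restriction to H matters. *)
Definition normal_subloop N H : Prop :=
  subloop H /\
  exists (L : loopType) (f : Q -> L),
    {in H &, {morph f : x y / x * y}} /\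
    (forall x, x \in N <-> x \in H /\ f x = 1).

Definition loop_lcoset x N : {set Q} := [set x * n | n in N].
Definition loop_cosets H N : {set {set Q}} := [set loop_lcoset x N | x in H].

(* The product of two cosets as sets of elements; loop_coset_mulE below *)
(* shows that it is the multiplication (xN)(yN) = (xy)N of H / N. *)
Definition loop_coset_mul (A B : {set Q}) : {set Q} :=
  [set a * b | a in A, b in B].

Lemma loop_coset_mulE N H x y : normal_subloop N H -> x \in H -> y \in H ->
  loop_coset_mul (loop_lcoset x N) (loop_lcoset y N) = loop_lcoset (x * y) N.
Proof.
case=> /andP[H1 /forall_inP clH] [L [f [fM defN]]] Hx Hy.
have HM u v : u \in H -> v \in H -> u * v \in H.
  by move=> Hu Hv; have /forall_inP/(_ v Hv)/and3P[] := clH u Hu.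
have HD u v : u \in H -> v \in H -> (Ltr u)^-1%g v \in H.
  by move=> Hu Hv; have /forall_inP/(_ v Hv)/and3P[] := clH u Hu.
have LD u v : u * (Ltr u)^-1%g v = v by have := permKV (Ltr u) v; rewrite permE.
have NH n : n \in N -> n \in H /\ f n = 1.
  by move/defN.
have inN n : n \in H -> f n = 1 -> n \in N by move=> Hn fn; apply/defN.
have f1 : f 1 = 1.
  by apply: (@loop_mulI L (f 1)); rewrite /= -fM // !lmull1.
apply/setP => z; apply/imset2P/imsetP.
  case=> _ _ /imsetP[n /NH[Hn fn] ->] /imsetP[m /NH[Hm fm] ->] ->.
  set w := x * n * (y * m).
  exists ((Ltr (x * y))^-1%g w); last by rewrite LD.
  have Hw : w \in H by rewrite !HM.
  apply: inN; first by apply: HD => //; apply: HM.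
  apply: (@loop_mulI L (f (x * y))).
  rewrite /= -fM ?HD ?HM // LD lmull1 /w !fM ?HM //.
  by rewrite fn fm !lmull1.
case=> n /NH[Hn fn] ->.
exists x ((Ltr x)^-1%g (x * y * n)); last by rewrite LD.
  by apply/imsetP; exists 1; rewrite ?lmull1 // inN.
have Hw : (Ltr x)^-1%g (x * y * n) \in H by rewrite HD // !HM.
apply/imsetP; exists ((Ltr y)^-1%g ((Ltr x)^-1%g (x * y * n))); last by rewrite LD.
apply: inN; first exact: HD.
have Hv := HD _ _ Hy Hw; move: (fM _ _ Hy Hv) (fM _ _ Hx Hw).
rewrite !LD !fM ?HM // fn lmull1 => e1 /(@loop_mulI L (f x)) e2.
by apply: (@loop_mulI L (f y)); rewrite /= lmull1 -e1.
Qed.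

End FinLoopDefs.

Definition is_abelian_group (T : finType) (G : {set T})
    (op : T -> T -> T) (e : T) : Prop :=
  [/\ {in G &, forall x y, op x y \in G},
      {in G & &, forall x y z, op x (op y z) = op (op x y) z},
      e \in G /\ {in G, forall x, op e x = x /\ op x e = x},
      {in G, forall x, exists2 y, y \in G & op y x = e /\ op x y = e} &
      {in G &, forall x y, op x y = op y x}].

Definition abelian_factor (Q : finLoopType) (H N : {set Q}) : Prop :=
  is_abelian_group (loop_cosets H N) (@loop_coset_mul Q) N.

Definition solvable_loop (Q : finLoopType) : Prop :=
  exists (m : nat) (S : nat -> {set Q}),
    [/\ S 0%N = [set 1], S m = [set: Q],
        (forall i, i <= m -> subloop (S i))%N,
        (forall i, i < m -> normal_subloop (S i) (S i.+1))%N &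
        (forall i, i < m -> abelian_factor (S i.+1) (S i))%N].

Definition pi_subloop (pi : nat_pred) (Q : finLoopType) (P : {set Q}) : bool :=
  subloop P && pi.-nat #|P|.

Definition Hall_subloops (pi : nat_pred) (Q : finLoopType) : {set {set Q}} :=
  [set P : {set Q} | subloop P && (#|P| == #|Q|`_pi)%N].

(* Main.v *)
Require Import Defs.
From mathcomp Require Import all_boot all_fingroup all_solvable.

(**
The nucleus N of an extra loop Q is the group of elements that associate with
all others.  The proof trades Hall's theorem for Q against Hall's theorem for
one of two finite solvable groups: N itself, or the quotient of Q by a small
normal 2-subgroup A.

Each element x gives an autotopism of Q, that is, a triple of permutations
(f, g, h) with f y * g w = h (y * w).  Combining these triples gives the inverse
property, both conjugacy-closed laws and the Moufang law, and comparing them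
shows that all squares are nuclear (sqr_nuc).  The triples also normalise the
triples (L_a, 1, L_a) with a in N, so N is invariant under every T_x
(Tmap_nuc), and x |-> T_x is multiplicative on N even where Q is not
associative (Tmap_nuc_comp).  Hence (xy)z and x(yz) act on N in the same way,
and their quotient, the associator c of x, y, z, centralises N as soon as it
lies in N.  It lies in N because squares are nuclear, so that Q / N is
commutative, and the conjugacy-closed laws turn a commutative loop into an
associative one (associator_nuc).  The same laws make c symmetric in x, y, z,
and c depends only on the classes of x, y, z modulo N.  The extra identity
says that T_x, hence T_y and T_z, inverts c; reversing the product shows that
the product of the three fixes c.  An odd number of inversions fixing c forces
c * c = 1 (associator_sqr).

So associators lie in the group A of elements of order at most 2 in the centre
of N, and Q / A is a group; so is Q / N, where every square is trivial.
- If 2 is in pi, then A is a normal pi-subloop, and the Hall pi-subloops of Q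
  are the preimages of those of the group Q / A.
- If 2 is not in pi, a pi-subloop has odd order, so its image in Q / N, a group
  of exponent dividing 2, is trivial: it lies in N.  As |Q : N| is a power of 2, the
  Hall pi-subloops of Q are the Hall pi-subgroups of the group N.
Both cases are instances of Hall_transfer, in which T_x becomes conjugation
by x.  The groups Q / A, Q / N and N are realised by permutations: the
quotients acting on cosets, N acting on Q by right translations.
*)

Set Implicit Arguments.
Unset Strict Implicit.
Unset Printing Implicit Defensive.

Local Open Scope loop_scope.

(** * Extra loops: inverse property, conjugacy closure, Moufang law *)

Section ExtraLoop.

Variable Q : finLoopType.
Hypothesis extraQ : extra_loop Q.
Implicit Types (x y z u v w a b c n : Q) (M : {set Q}).

Lemma LtrE x y : Ltr x y = x * y. Proof. exact: permE. Qed.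
Lemma RtrE x y : Rtr x y = y * x. Proof. exact: permE. Qed.

Definition linv x : Q := (Ltr x)^-1%g 1.
Local Notation "x ^-1" := (linv x) : loop_scope.

Lemma lmulV x : x * x^-1 = 1.
Proof. by rewrite -LtrE permKV. Qed.

Lemma lmulI x : injective (lmul x). Proof. exact: loop_mulI. Qed.

Lemma lflex x y : (x * y) * x = x * (y * x).
Proof. by have := extraQ x y 1; rewrite lmull1 lmul1l. Qed.

(** The extra identity at y := x^-1; every element has the form z * x, so the
    left inverse property follows. *)
Lemma lmulVKl x u : x * (x^-1 * u) = u.
Proof.
have := extraQ x x^-1 ((Rtr x)^-1%g u).
by rewrite lmulV lmul1l -RtrE permKV.
Qed.

Lemma lVmul x : x^-1 * x = 1.
Proof. by apply: (@lmulI x); rewrite lmulVKl lmull1. Qed.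

Lemma linvK x : x^-1^-1 = x.
Proof. by apply: (@lmulI x^-1); rewrite lmulV lVmul. Qed.

Lemma lmulKl x u : x^-1 * (x * u) = u.
Proof. by have := lmulVKl x^-1 u; rewrite linvK. Qed.

Lemma lmulVKr x u : (u * x^-1) * x = u.
Proof.
by have := extraQ x (x^-1 * u) x^-1; rewrite lmulVKl lVmul lmull1 lmulVKl.
Qed.

Lemma lmulKr x u : (u * x) * x^-1 = u.
Proof. by have := lmulVKr x^-1 u; rewrite linvK. Qed.

Lemma linvM x y : (x * y)^-1 = y^-1 * x^-1.
Proof.
apply: (@lmulI y); rewrite lmulVKl.
by have := lmulKr (x * y) x^-1; rewrite lmulKl.
Qed.

Lemma lconjA x w : (x^-1 * w) * x = x^-1 * (w * x).
Proof. by apply: (@lmulI x); rewrite -lflex !lmulVKl. Qed.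

(** The extra identity as the autotopism (L_x, R_x^-1, L_x R_x^-1).  In a loop
    with the inverse property the three components of an autotopism may be
    permuted, up to conjugation by inversion; this yields both conjugacy-closed
    laws below. *)
Lemma extra_autotopism x y w : (x * y) * (w * x^-1) = (x * (y * w)) * x^-1.
Proof. by apply: (@loop_Imul Q x); rewrite /= extraQ !lmulVKr. Qed.

Lemma left_conjugacy_closed x u v :
  x * (u * v) = ((x * u) * x^-1) * (x * v).
Proof.
have := extra_autotopism x (u * v) v^-1; rewrite lmulKr -linvM => <-.
by rewrite lmulVKr.
Qed.

Lemma right_conjugacy_closed x y w :
  (y * w) * x = (y * x) * (x^-1 * (w * x)).
Proof.
have := extra_autotopism x^-1 y^-1 (y * w).
by rewrite lmulKl -linvM linvK lconjA => <-; rewrite lmulVKl.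
Qed.

(** The conjugacy-closed laws are the autotopisms (L_x R_x^-1, L_x, L_x) and
    (R_x, L_x^-1 R_x, R_x), whose composite is (L_x, R_x, L_x R_x). *)
Lemma moufang x u v : (x * u) * (v * x) = x * ((u * v) * x).
Proof.
rewrite -[RHS]lflex [x * (u * v)]left_conjugacy_closed.
by rewrite [RHS]right_conjugacy_closed lmulVKr lflex lmulKl.
Qed.

(** The Moufang autotopism and that of the extra identity have the same first
    component; their quotient is (1, R_x^2, R_x^2). *)
Lemma sqr_assoc x y w : (y * w) * (x * x) = y * (w * (x * x)).
Proof.
have dbl u v : u * ((v * x) * x) = ((u * v) * x) * x.
  by apply: (@lmulI x); rewrite -extraQ moufang lflex.
have alt u : u * (x * x) = (u * x) * x by have := dbl u 1; rewrite lmul1l lmull1.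
by rewrite !alt dbl.
Qed.

(** * The nucleus *)

(** This is the right nucleus.  In a loop with the inverse property the three
    nuclei coincide: see nuc_l and nuc_m. *)
Definition nucleus : {set Q} :=
  [set a | [forall x, forall y, (x * y) * a == x * (y * a)]].
Local Notation N := nucleus.

Lemma nucP a : reflect (forall x y, (x * y) * a = x * (y * a)) (a \in N).
Proof.
rewrite inE; apply: (iffP forallP) => [h x y | h x]; last first.
  by apply/forallP=> y; apply/eqP.
by apply/eqP; have /forallP := h x.
Qed.

Lemma nuc_r a x y : a \in N -> (x * y) * a = x * (y * a).
Proof. by move/nucP. Qed.

Lemma nuc1 : 1 \in N.
Proof. by apply/nucP=> x y; rewrite !lmull1. Qed.

Lemma nucV a : a \in N -> a^-1 \in N.
Proof.
move=> Na; apply/nucP=> x y.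
by apply: (@loop_Imul Q a) => /=; rewrite [RHS]nuc_r // !lmulVKr.
Qed.

Lemma nuc_l a x y : a \in N -> (a * x) * y = a * (x * y).
Proof.
move/nucV=> Na; rewrite -[LHS]linvK -[RHS]linvK; congr (_^-1).
by rewrite !linvM nuc_r.
Qed.

Lemma nuc_m a x y : a \in N -> (x * a) * y = x * (a * y).
Proof.
move=> Na; apply: (@lmulI (x * a)^-1); rewrite lmulKl linvM.
by rewrite nuc_l ?nucV // !lmulKl.
Qed.

Lemma nucM a b : a \in N -> b \in N -> a * b \in N.
Proof. by move=> Na Nb; apply/nucP=> x y; rewrite -!(nuc_r _ _ Nb) (nuc_r x y Na). Qed.

Lemma left_nuc b : (forall x y, (b * x) * y = b * (x * y)) -> b \in N.
Proof.
move=> lb; rewrite -[b]linvK; apply: nucV; apply/nucP=> x y.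
rewrite -[LHS]linvK -[RHS]linvK; congr (_^-1).
by rewrite !linvM !linvK lb.
Qed.

Lemma sqr_nuc x : x * x \in N.
Proof. by apply/nucP=> y w; rewrite sqr_assoc. Qed.

(** With gamma y = x * y * x^-1, the conjugate of the autotopism (L_a, 1, L_a) by
    the left conjugacy-closed autotopism (gamma, L_x, L_x) is (L_b, 1, L_b) with
    b = gamma a. *)
Lemma nuc_conj x a : a \in N -> (x * a) * x^-1 \in N.
Proof.
move=> Na; set b := _ * _; apply: left_nuc => y w.
have bx v : b * (x * v) = x * (a * v) by rewrite [RHS]left_conjugacy_closed.
have gamma u v : b * ((x * u) * x^-1 * (x * v)) = ((x * (a * u)) * x^-1) * (x * v).
  by rewrite -(left_conjugacy_closed x u) -(left_conjugacy_closed x (a * u)) bx nuc_l.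
have by_ u : b * ((x * u) * x^-1) = (x * (a * u)) * x^-1.
  by have := gamma u x^-1; rewrite !lmulV !lmull1.
rewrite -[w](lmulVKl x) -[y](lmulKr x) -[y * x](lmulVKl x).
by rewrite gamma by_.
Qed.

Lemma TmapE x y : Tmap x y = x^-1 * (y * x).
Proof. by apply: (@lmulI x); rewrite TmapP lmulVKl. Qed.

Lemma Tmap_nuc x a : a \in N -> Tmap x a \in N.
Proof.
move=> Na; have := nuc_conj x^-1 Na.
by rewrite linvK TmapE nuc_m.
Qed.

Lemma Tmap_nuc_onto x b : b \in N -> exists2 a, a \in N & Tmap x a = b.
Proof.
move=> Nb; exists ((x * b) * x^-1); first exact: nuc_conj.
by rewrite TmapE lmulVKr lmulKl.
Qed.

Lemma Tmap_nucM x a b : a \in N -> b \in N ->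
  Tmap x (a * b) = Tmap x a * Tmap x b.
Proof.
move=> Na Nb; apply: (@lmulI x); rewrite TmapP.
by rewrite -(nuc_r _ _ (Tmap_nuc x Nb)) TmapP !nuc_l // TmapP.
Qed.

Lemma Tmap1 x : Tmap x 1 = 1.
Proof. by rewrite TmapE lmul1l lVmul. Qed.

Lemma Tmap_nucV x a : a \in N -> Tmap x a^-1 = (Tmap x a)^-1.
Proof.
move=> Na; apply: (@lmulI (Tmap x a)).
by rewrite -Tmap_nucM ?nucV // !lmulV Tmap1.
Qed.

(** As a nuclear element can be moved past u and then v, the T-maps act on the
    nucleus as if Q were associative. *)
Lemma Tmap_nuc_comp u v a : a \in N -> Tmap (u * v) a = Tmap v (Tmap u a).
Proof.
move=> Na; apply: (@lmulI (u * v)); rewrite TmapP.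
have Nu := Tmap_nuc u Na; have Nv := Tmap_nuc v Nu.
by rewrite (nuc_r _ _ Nv) TmapP -(nuc_m _ _ Nu) TmapP nuc_l.
Qed.

(** Q / N is commutative because it has the inverse property and exponent dividing 2:
    x * u is, modulo N, equal to its inverse u^-1 * x^-1, thus to u * x. *)
Lemma lcomm_nuc x u : exists2 n, n \in N & x * u = (u * x) * n.
Proof.
have inv_sq w : exists2 s, s \in N & w^-1 = w * s.
  by exists (w^-1 * w^-1); rewrite ?sqr_nuc // lmulVKl.
have [p Np pE] := inv_sq u; have [q Nq qE] := inv_sq x.
have [s Ns sE] := inv_sq (x * u).
have Np' := Tmap_nuc x Np.
have : (x * u) * s = (u * x) * (Tmap x p * q).
  rewrite -sE linvM pE qE -(nuc_r _ _ Nq) (nuc_m _ _ Np) -(TmapP x p).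
  by rewrite -(nuc_r _ _ Np') (nuc_r _ _ Nq).
move=> e; exists ((Tmap x p * q) * s^-1); first by rewrite !nucM ?nucV.
by rewrite -(nuc_r _ _ (nucV Ns)) -e lmulKr.
Qed.

(** The left conjugacy-closed law says that x and u may be swapped at the cost of
    the factor n = (x * u * x^-1) / u, which is nuclear as Q / N is commutative and
    does not depend on v.  The case v = 1 shows that the same n compares x * u
    with u * x; this makes associators symmetric. *)
Lemma lcc_swap x u : exists2 n, n \in N & forall v, x * (u * v) = n * (u * (x * v)).
Proof.
have [m Nm mE] := lcomm_nuc x u.
have Nm' := Tmap_nuc x^-1 Nm; have Nn := nuc_conj u Nm'.
exists ((u * (Tmap x^-1 m)) * u^-1) => // v.
rewrite left_conjugacy_closed -(nuc_l u _ Nn) lmulVKr; congr (_ * _).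
by rewrite mE (nuc_m _ _ Nm) -(TmapP x^-1 m) -(nuc_r _ _ Nm') lmulKr.
Qed.

Lemma rcc_swap x w : exists2 n, n \in N & forall y, (y * w) * x = ((y * x) * w) * n.
Proof.
have [m Nm mE] := lcomm_nuc w x; exists m => // y.
by rewrite right_conjugacy_closed mE -(nuc_r x^-1 _ Nm) lmulKl -(nuc_r _ _ Nm).
Qed.

(** * Associators *)

Definition associator x y z : Q := (x * (y * z))^-1 * ((x * y) * z).

Lemma associatorP x y z : (x * y) * z = (x * (y * z)) * associator x y z.
Proof. by rewrite lmulVKl. Qed.

Lemma associator_uniq x y z c :
  (x * y) * z = (x * (y * z)) * c -> associator x y z = c.
Proof. by rewrite associatorP => /lmulI. Qed.

(** Modulo N, x(yz) = x(zy) = z(xy) = (xy)z by commutativity and lcc_swap. *)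
Lemma associator_nuc x y z : associator x y z \in N.
Proof.
have [m Nm mE] := lcomm_nuc y z.
have [n Nn nE] := lcc_swap x z.
have [k Nk kE] := lcomm_nuc z (x * y).
set W := (x * y) * z in kE *.
have Nn' := Tmap_nuc W Nn.
have WE : x * (y * z) = W * ((Tmap W n * k) * m).
  rewrite mE -(nuc_r x _ Nm) nE kE -(nuc_r n W Nk) -(TmapP W n).
  by rewrite -(nuc_r W _ Nm) -(nuc_r W _ Nk).
by rewrite /associator -/W WE linvM lmulVKr nucV ?nucM.
Qed.

(** (xy)z and x(yz) induce the same T-map on N, namely T_x, T_y, T_z in turn, so
    the T-map of their quotient c is trivial on N. *)
Lemma associator_comm x y z a : a \in N ->
  associator x y z * a = a * associator x y z.
Proof.
move=> Na; set c := associator x y z; have Nc : c \in N := associator_nuc x y z.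
have [b Nb bE] := Tmap_nuc_onto (x * (y * z)) Na.
have : Tmap ((x * y) * z) b = a.
  by rewrite -bE !Tmap_nuc_comp ?Tmap_nuc.
rewrite associatorP Tmap_nuc_comp // bE -/c => Tc.
by rewrite -(TmapP c) Tc.
Qed.

Lemma associatorCl x y z : associator x y z = associator y x z.
Proof.
have [n Nn nE] := lcc_swap x y; apply: associator_uniq.
have := nE 1; rewrite !lmull1 => ->.
by rewrite (nuc_l _ _ Nn) (associatorP y x) nE (nuc_l _ _ Nn).
Qed.

Lemma associatorCr x y z : associator x y z = associator x z y.
Proof.
have [n Nn nE] := rcc_swap z y; apply: associator_uniq.
have := nE 1; rewrite !lmul1l => yz.
rewrite nE (associatorP x z) yz -(nuc_r x _ Nn) (nuc_r _ _ Nn).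
by rewrite associator_comm // (nuc_r _ _ (associator_nuc _ _ _)).
Qed.

Lemma associatorMr x y z a : a \in N -> associator x y (z * a) = associator x y z.
Proof.
move=> Na; apply: associator_uniq.
rewrite -(nuc_r (x * y) z Na) (associatorP x y z) -(nuc_r y z Na) -(nuc_r x _ Na).
by rewrite (nuc_r _ _ Na) associator_comm // -(nuc_r _ a (associator_nuc x y z)).
Qed.

Lemma associatorVr x y z : associator x y z^-1 = associator x y z.
Proof.
by rewrite -(lmulVKl z z^-1) associatorMr ?sqr_nuc.
Qed.

(** x^-1 = x * (x^-1 * x^-1) differs from x by a nuclear factor, and a nuclear
    factor in the last argument, hence by symmetry in any argument, has no effect
    on an associator. *)
Lemma associatorV x y z : associator x^-1 y^-1 z^-1 = associator x y z.
Proof.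
rewrite associatorVr associatorCr associatorVr associatorCl associatorCr.
by rewrite associatorVr associatorCr associatorCl associatorCr.
Qed.

(** Reassociating ((xy)z)x to x(y(zx)) costs c = (x, y, z), moved past x, and then
    (y, z, x) = c; by the extra identity the total cost T_x c * c is trivial. *)
Lemma Tmap_associator x y z : Tmap x (associator x y z) = (associator x y z)^-1.
Proof.
set c := associator x y z; have Nc : c \in N := associator_nuc x y z.
have NT := Tmap_nuc x Nc.
apply: (@lmulI c); rewrite lmulV.
apply: (@lmulI (x * (y * (z * x)))); rewrite lmull1 -(nuc_r _ _ NT).
have cE : associator y z x = c by rewrite associatorCr associatorCl.
rewrite (nuc_r x _ Nc) -{1}cE -(associatorP y z x) -lflex (nuc_r _ x NT) (TmapP x c).
by rewrite -(nuc_m _ x Nc) -(associatorP x y z) extraQ.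
Qed.

(** Inverting both sides of (xy)z = (x(yz))c shows that T_w fixes c for
    w = z^-1(y^-1 x^-1), while T_w is a composite of three maps inverting c. *)
Lemma associator_sqr x y z : associator x y z * associator x y z = 1.
Proof.
set c := associator x y z; have Nc : c \in N := associator_nuc x y z.
pose w := z^-1 * (y^-1 * x^-1).
have rev : associator z y x = c.
  by rewrite associatorCr associatorCl associatorCr.
have Tw : Tmap w c = c.
  rewrite -[RHS]rev -[RHS]associatorV; apply/esym/associator_uniq.
  rewrite -/w TmapP /w -!linvM (associatorP x y z) -/c.
  by rewrite (linvM _ c) lmulVKl.
have Tx : Tmap x^-1 c = c^-1.
  rewrite /c -[associator x y z]associatorV Tmap_associator.
  by [].
have Ty : Tmap y^-1 c = c^-1.
  rewrite /c -[associator x y z]associatorV associatorCl Tmap_associator.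
  by [].
have Tz : Tmap z^-1 c = c^-1.
  by rewrite -rev -[associator z y x]associatorV Tmap_associator.
have : Tmap w c = c^-1.
  rewrite (Tmap_nuc_comp _ _ Nc) Tz Tmap_nuc_comp ?nucV // Tmap_nucV // Ty.
  by rewrite linvK Tx.
by rewrite Tw => {1}->; rewrite lVmul.
Qed.

(** * Nuclear congruences and the coset representation *)

(** The identity is included, so that this is the subgroup of elements of order
    at most 2 in the centre of N. *)
Definition central_involutions : {set Q} :=
  [set a in N | (a * a == 1) && [forall b in N, a * b == b * a]].
Local Notation A := central_involutions.

Lemma central_involutionsP a :
  reflect [/\ a \in N, a * a = 1 & {in N, forall b, a * b = b * a}] (a \in A).
Proof.
rewrite [a \in A]in_set; apply: (iffP and3P) => [[Na /eqP a2 /forall_inP ca] | [Na a2 ca]].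
  by split=> // b /ca/eqP.
by split=> //; [apply/eqP | apply/forall_inP=> b /ca ->].
Qed.

(** A subgroup M of N closed under all T_x is normal in Q; containing the associators
    makes the quotient Q / M a group. *)
Record nuclear_congruence M : Prop := NuclearCongruence {
  nc1 : 1 \in M;
  ncM : {in M &, forall a b, a * b \in M};
  nc_nuc : {subset M <= N};
  ncT : forall x, {in M, forall a, Tmap x a \in M};
  nc_assoc : forall x y z, associator x y z \in M
}.

Lemma nuclear_congruence_nucleus : nuclear_congruence N.
Proof.
split=> //; [exact: nuc1 | exact: nucM | exact: Tmap_nuc | exact: associator_nuc].
Qed.

Lemma nuclear_congruence_central_involutions : nuclear_congruence A.
Proof.
split.
- apply/central_involutionsP; split=> [||b _]; first exact: nuc1.
    by rewrite lmul1l.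
  by rewrite lmul1l lmull1.
- move=> a b /central_involutionsP[Na a2 ca] /central_involutionsP[Nb b2 cb].
  apply/central_involutionsP; split=> [||d Nd]; first exact: nucM.
    by rewrite -(nuc_r _ _ Nb) (ca b Nb) (nuc_r b a Na) a2 lmull1.
  by rewrite (nuc_r a b Nd) cb // -(nuc_r _ _ Nb) ca // (nuc_r _ _ Nb).
- by move=> a /central_involutionsP[].
- move=> x a /central_involutionsP[Na a2 ca].
  apply/central_involutionsP; split=> [||b]; first exact: Tmap_nuc.
    by rewrite -Tmap_nucM // a2 Tmap1.
  by case/(Tmap_nuc_onto x)=> d Nd <-; rewrite -!Tmap_nucM // ca.
- move=> x y z; apply/central_involutionsP.
  split; [exact: associator_nuc | exact: associator_sqr | exact: associator_comm].
Qed.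

Section CosetAction.

Variable M : {set Q}.
Hypothesis ncongM : nuclear_congruence M.
Local Notation cosets := (loop_cosets [set: Q] M).

Lemma card_loop_lcoset u : #|loop_lcoset u M| = #|M|.
Proof. by apply: card_imset; apply: lmulI. Qed.

Lemma mem_loop_cosets u : loop_lcoset u M \in cosets.
Proof. exact: imset_f. Qed.

Lemma loop_lcoset_Rtr u x : Rtr x @: loop_lcoset u M = loop_lcoset (u * x) M.
Proof.
apply/eqP; rewrite eqEcard (card_imset _ perm_inj) !card_loop_lcoset leqnn andbT.
apply/subsetP=> _ /imsetP[_ /imsetP[n Mn ->] ->]; have Nn := nc_nuc ncongM Mn.
apply/imsetP; exists (Tmap x n); first exact: ncT.
by rewrite RtrE (nuc_m _ _ Nn) -(TmapP x n) -(nuc_r _ _ (Tmap_nuc x Nn)).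
Qed.

Lemma loop_lcosetM u a : a \in M -> loop_lcoset (u * a) M = loop_lcoset u M.
Proof.
move=> Ma; apply/eqP; rewrite eqEcard !card_loop_lcoset leqnn andbT.
apply/subsetP=> _ /imsetP[n Mn ->]; apply/imsetP; exists (a * n).
  exact: ncM.
by rewrite (nuc_r _ _ (nc_nuc ncongM Mn)).
Qed.

(** The right regular representation of the group Q / M, extended by the identity
    to the subsets of Q that are not cosets of M. *)
Definition coset_perm x : {perm {set Q}} :=
  restr_perm cosets (actperm 'P^* (Rtr x)).

Lemma coset_permE x u :
  coset_perm x (loop_lcoset u M) = loop_lcoset (u * x) M.
Proof.
have setE B : actperm 'P^* (Rtr x) B = Rtr x @: B.
  by rewrite actpermE.
rewrite restr_permE ?mem_loop_cosets //; first by rewrite setE loop_lcoset_Rtr.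
rewrite !inE; apply/subsetP=> _ /imsetP[v _ ->].
by rewrite inE /= /aperm setE loop_lcoset_Rtr mem_loop_cosets.
Qed.

Lemma coset_perm_out x B : B \notin cosets -> coset_perm x B = B.
Proof. by move=> nB; apply: out_perm (restr_perm_on _ _) nB. Qed.

Lemma coset_permM x y : coset_perm (x * y) = (coset_perm x * coset_perm y)%g.
Proof.
apply/permP=> B; rewrite permM; have [/imsetP[u _ ->]|nB] := boolP (B \in cosets).
  by rewrite !coset_permE (associatorP u x y) (loop_lcosetM _ (nc_assoc ncongM u x y)).
by rewrite !(coset_perm_out _ nB).
Qed.

Lemma coset_perm_eq1 x : (coset_perm x == 1%g) = (x \in M).
Proof.
apply/eqP/idP=> [fx | Mx].
  have : x \in loop_lcoset (1 * x) M.
    by apply/imsetP; exists 1; rewrite ?(nc1 ncongM) // lmul1l lmull1.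
  by rewrite -coset_permE fx perm1 => /imsetP[n Mn ->]; rewrite lmul1l.
apply/permP=> B; rewrite perm1; have [/imsetP[u _ ->]|nB] := boolP (B \in cosets).
  by rewrite coset_permE loop_lcosetM.
by rewrite coset_perm_out.
Qed.

End CosetAction.
End ExtraLoop.

(** * Subloops of finite loops *)

Section Subloops.

Variable Q : finLoopType.
Implicit Types (x y : Q) (P : {set Q}).

Local Notation ldiv x := ((Ltr x)^-1)%g.

Lemma mul_ldiv x y : x * ldiv x y = y.
Proof. by have := permKV (Ltr x) y; rewrite permE. Qed.

Lemma subloop1 P : subloop P -> 1 \in P.
Proof. by case/andP. Qed.

Lemma subloopM P : subloop P -> {in P &, forall x y, x * y \in P}.
Proof. by case/andP=> _ /forall_inP h x y /h/forall_inP h' /h'/and3P[]. Qed.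

Lemma subloop_ldiv P : subloop P -> {in P &, forall x y, ldiv x y \in P}.
Proof. by case/andP=> _ /forall_inP h x y /h/forall_inP h' /h'/and3P[]. Qed.

(** By finiteness a translation that maps P into P permutes P. *)
Lemma closed_subloop P : 1 \in P -> {in P &, forall x y, x * y \in P} -> subloop P.
Proof.
move=> P1 PM; rewrite /subloop P1; apply/forall_inP=> x Px; apply/forall_inP=> y Py.
have stable (s : {perm Q}) : {in P, forall z, s z \in P} -> (s^-1)%g y \in P.
  move=> sP; have /eqP sE : s @: P == P.
    rewrite eqEcard card_imset ?leqnn ?andbT; last exact: perm_inj.
    by apply/subsetP=> _ /imsetP[z Pz ->]; apply: sP.
  by move: Py; rewrite -{1}sE => /imsetP[z Pz ->]; rewrite permK.
rewrite PM //=; apply/andP; split; apply: stable => z Pz.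
  by rewrite permE; apply: PM.
by rewrite permE; apply: PM.
Qed.

Lemma subloopT : subloop [set: Q].
Proof. by apply: closed_subloop => [|x y _ _]; rewrite in_setT. Qed.

Lemma subloopI P1 P2 : subloop P1 -> subloop P2 -> subloop (P1 :&: P2).
Proof.
move=> sl1 sl2; apply: closed_subloop; first by rewrite inE !subloop1.
by move=> x y /setIP[? ?] /setIP[? ?]; rewrite inE !subloopM.
Qed.

End Subloops.

(** * Transferring Hall's theorem along a multiplicative map *)

Section LoopToGroup.

Variables (Q : finLoopType) (gT : finGroupType) (K : {set Q}) (f : Q -> gT).
Hypotheses (slK : subloop K).
Hypothesis fM : {in K &, forall x y, f (x * y) = (f x * f y)%g}.
Implicit Types (x y : Q) (P : {set Q}).

Local Notation ldiv x := ((Ltr x)^-1)%g.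

Lemma loop_morph1 : f 1 = 1%g.
Proof.
apply: (mulgI (f 1)); rewrite -fM ?subloop1 // lmull1 mulg1 //.
Qed.

Lemma loop_morph_ldiv : {in K &, forall x y, f (ldiv x y) = ((f x)^-1 * f y)%g}.
Proof.
move=> x y Kx Ky; apply: (mulgI (f x)).
by rewrite -fM ?subloop_ldiv // mul_ldiv mulKVg.
Qed.

Lemma subloop_image P : subloop P -> P \subset K -> group_set (f @: P).
Proof.
move=> slP /subsetP PK; apply/group_setP; split.
  by apply/imsetP; exists 1; rewrite ?loop_morph1 ?subloop1.
move=> _ _ /imsetP[x Px ->] /imsetP[y Py ->].
by rewrite -fM ?PK //; apply: imset_f; apply: subloopM.
Qed.

(** The fibres of f on P are left translates of the kernel. *)
Lemma card_subloop_image P : subloop P -> P \subset K ->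
  #|P| = (#|f @: P| * #|[set x in P | f x == 1%g]|)%N.
Proof.
move=> slP PK; rewrite -sum1_card (partition_big_imset f) /= -sum_nat_const.
apply: eq_bigr => _ /imsetP[x Px ->].
have Kx := subsetP PK x Px.
rewrite sum1dep_card -(card_imset (mem [set y in P | f y == 1%g]) (@loop_mulI Q x)).
apply: eq_card => y; rewrite inE; apply/andP/imsetP=> [[Py /eqP fy] | [z]].
  exists (ldiv x y); last by rewrite mul_ldiv.
  have Ky := subsetP PK y Py.
  by rewrite inE subloop_ldiv // loop_morph_ldiv // fy mulVg /=.
rewrite inE => /andP[Pz /eqP fz] ->; split; first exact: subloopM.
by rewrite fM ?fz ?mulg1 // (subsetP PK).
Qed.

Definition loop_preim (B : {set gT}) : {set Q} := [set x in K | f x \in B].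

Lemma loop_preim_subloop (H : {group gT}) : subloop (loop_preim H).
Proof.
apply: closed_subloop; first by rewrite inE subloop1 // loop_morph1 group1.
move=> x y; rewrite !inE => /andP[Kx Hx] /andP[Ky Hy].
by rewrite subloopM // fM // groupM.
Qed.

Lemma card_loop_preim (H : {group gT}) : H \subset f @: K ->
  #|loop_preim H| = (#|H| * #|[set x in K | f x == 1%g]|)%N.
Proof.
move=> sHK.
rewrite (card_subloop_image (loop_preim_subloop H)); last first.
  by apply/subsetP=> x; rewrite inE => /andP[].
congr (_ * _)%N; apply: eq_card => y.
  apply/imsetP/idP=> [[x] | Hy]; first by rewrite inE => /andP[_ Hx] ->.
  by have /imsetP[x Kx yE] := subsetP sHK y Hy; exists x; rewrite // inE Kx -yE.
by rewrite !inE; case: eqP => [->|]; rewrite ?group1 ?andbT ?andbF.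
Qed.

Lemma loop_morph_Tmap :
  {in K &, forall x y, Tmap x y \in K /\ f (Tmap x y) = (f y ^ f x)%g}.
Proof.
move=> x y Kx Ky; have TE : Tmap x y = ldiv x (y * x).
  by apply: (@loop_mulI _ x); rewrite /= TmapP mul_ldiv.
by rewrite TE subloop_ldiv ?subloopM // loop_morph_ldiv ?subloopM // fM.
Qed.

(** Each abelian factor S_{i+1} / S_i forces x * y and y * x to differ by an element
    of S_i, so that commutators of images from S_{i+1} lie in the image of S_i and
    the derived series of G descends along the series of Q. *)
Lemma solvable_loop_image (hsol : solvable_loop Q) (G : {group gT}) :
  G :=: f @: K -> solvable G.
Proof.
case: hsol => m [S [S0 Sm slS nS aS]] defG.
have sl i : (i <= m)%N -> subloop (K :&: S i) by move=> im; rewrite subloopI ?slS.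
apply/derivedP; exists m.
suff der i : (i <= m)%N -> (G^`(i) \subset f @: (K :&: S (m - i)%N))%g.
  apply/trivgP/(subset_trans (der m (leqnn m))); rewrite subnn S0.
  apply/subsetP=> _ /imsetP[x /setIP[_ /set1P ->] ->].
  by rewrite loop_morph1 inE.
elim: i => [_|i IHi lim]; first by rewrite derg0 subn0 Sm setIT defG.
have lt : (m - i.+1 < m)%N by rewrite ltn_subrL (leq_ltn_trans _ lim).
have sE : (m - i = (m - i.+1).+1)%N by rewrite -subSn // subSS.
have gH := subloop_image (sl _ (ltnW lt)) (subsetIl _ _).
rewrite dergSn -[f @: _]/(gval (Group gH)) gen_subG.
apply/subsetP=> _ /imset2P[_ _ /(subsetP (IHi (ltnW lim))) /imsetP[x Sx ->]
  /(subsetP (IHi (ltnW lim))) /imsetP[y Sy ->] ->] /=.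
move: Sx Sy; rewrite sE; set j := (m - i.+1)%N in lt gH *.
case/setIP=> Kx Sx /setIP[Ky Sy].
have [_ _ _ _ abel] := aS j lt.
have cxy := abel _ _ (imset_f _ Sx) (imset_f _ Sy).
rewrite /= !(loop_coset_mulE (nS j lt)) // in cxy.
have : x * y \in loop_lcoset (y * x) (S j).
  (* both sides of cxy are cosets, and x * y lies in its own *)
  rewrite -cxy; apply/imsetP; exists 1; last by rewrite lmull1.
  exact/subloop1/slS/ltnW.
case/imsetP=> n Sn xyE.
have nE : n = ldiv (y * x) (x * y).
  by apply: (@loop_mulI _ (y * x)); rewrite /= mul_ldiv.
have Kn : n \in K by rewrite nE subloop_ldiv ?subloopM.
apply/imsetP; exists n; first by rewrite inE Kn.
rewrite nE loop_morph_ldiv ?subloopM // !fM //.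
by rewrite /commg /conjg !invMg !mulgA.
Qed.

Lemma sqr1_image P : subloop P -> P \subset K ->
  {in P, forall x, f (x * x) = 1%g} -> 2.-nat #|f @: P|.
Proof.
move=> slP PK sqr1; set G := Group (subloop_image slP PK).
have -> : f @: P = G by [].
apply/pnatP; first exact: cardG_gt0.
move=> p prp /(Cauchy prp)[_ /imsetP[x Px ->] ordx].
have : (f x ^+ 2 = 1)%g by rewrite expgS expg1 -fM ?sqr1 ?(subsetP PK).
by move/eqP; rewrite -order_dvdn ordx dvdn_prime2.
Qed.

(** The image is a 2-group whose order divides the odd number |P|. *)
Lemma subloop_card_odd P : subloop P -> P \subset K ->
  {in P, forall x, f (x * x) = 1%g} -> odd #|P| -> {in P, forall x, f x = 1%g}.
Proof.
move=> slP PK sqr1 oddP x Px.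
have : coprime #|f @: P| #|f @: P|.
  apply: (@pnat_coprime 2); first exact: sqr1_image.
  rewrite p'natE //; apply: contraL oddP => d2; rewrite -dvdn2 .
  by apply: dvdn_trans d2 _; rewrite (card_subloop_image slP PK) dvdn_mulr.
rewrite /coprime gcdnn => /cards1P[g fPE].
have := imset_f f Px; rewrite fPE => /set1P ->.
have := imset_f f (subloop1 slP); rewrite fPE => /set1P <-; exact: loop_morph1.
Qed.

(** A Hall pi-subloop P lies in the preimage of a Hall subgroup containing its
    image; as the kernel is a pi-set, that preimage has order |Q|_pi = |P| and so is
    P itself.  Hall pi-subloops are thus exactly the preimages of the Hall
    pi-subgroups of f(K), and f turns T_x into conjugation by f x. *)
Lemma Hall_transfer pi : solvable_loop Q ->
  pi.-nat #|[set x in K | f x == 1%g]| ->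
  (#|K|`_pi = #|Q|`_pi)%N ->
  (forall P, pi_subloop pi P -> P \subset K) ->
  [/\ exists P : {set Q}, P \in Hall_subloops pi Q,
      forall P1 P2 : {set Q},
        P1 \in Hall_subloops pi Q -> P2 \in Hall_subloops pi Q ->
        exists x : Q, [set Tmap x y | y in P1] = P2
    & forall P : {set Q}, pi_subloop pi P ->
        exists2 H : {set Q}, H \in Hall_subloops pi Q & P \subset H].
Proof.
move=> solQ pi_ker cardK piK; set k := #|_| in pi_ker.
pose G := Group (subloop_image slK (subxx K)).
have solG : solvable G by apply: solvable_loop_image.
have KE : #|K| = (#|G| * k)%N by apply: card_subloop_image.
have QE : (#|Q|`_pi = #|G|`_pi * k)%N.
  have k_gt0 : (0 < k)%N by case/andP: pi_ker.
  by rewrite -cardK KE partnM ?cardG_gt0 // (part_pnat_id pi_ker).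
have hall_preim (H : {group gT}) : pi.-Hall(G)%g H -> loop_preim H \in Hall_subloops pi Q.
  move=> hallH; rewrite inE loop_preim_subloop /= card_loop_preim ?(pHall_sub hallH) //.
  by rewrite (card_Hall hallH) QE.
have sub_image P : subloop P -> P \subset K -> P \subset loop_preim (f @: P).
  move=> slP PK; apply/subsetP=> x Px; rewrite inE (subsetP PK) //.
  exact: imset_f.
have image_pi P (slP : subloop P) (PK : P \subset K) :
    pi.-nat #|P| -> pi.-group%g (Group (subloop_image slP PK)).
  by rewrite (card_subloop_image slP PK) pnatM => /andP[].
have sub_hall P : pi_subloop pi P -> exists2 H : {group gT},
    pi.-Hall(G)%g H & P \subset loop_preim H.
  move=> piP; have PK := piK P piP; have /andP[slP natP] := piP.
  have sG : Group (subloop_image slP PK) \subset G by apply: imsetS.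
  have [H hallH sPH] := Hall_superset solG sG (image_pi P slP PK natP).
  exists H => //; apply: subset_trans (sub_image P slP PK) _.
  by apply/subsetP=> x; rewrite !inE => /andP[-> /(subsetP sPH)].
have hallE P : P \in Hall_subloops pi Q -> exists2 H : {group gT},
    pi.-Hall(G)%g H & P = loop_preim H.
  rewrite inE => /andP[slP /eqP cardP].
  have [|H hallH sPH] := sub_hall P; first by rewrite /pi_subloop slP cardP part_pnat.
  exists H => //; apply/eqP; rewrite eqEcard sPH cardP.
  by have := hall_preim H hallH; rewrite inE => /andP[_ /eqP ->]; rewrite leqnn.
split.
- have [H hallH] := Hall_exists pi solG.
  by exists (loop_preim H); apply: hall_preim.
- move=> P1 P2 hallP1 /hallE[H2 hall2 ->].
  have [H1 hall1 ->] := hallE _ hallP1.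
  have [g Gg H2E] := Hall_trans solG hall2 hall1.
  have /imsetP[x Kx gE] := Gg; exists x; apply/eqP.
  rewrite eqEcard (card_imset _ perm_inj).
  rewrite !card_loop_preim ?(pHall_sub hall1) ?(pHall_sub hall2) //.
  rewrite (card_Hall hall1) (card_Hall hall2) leqnn andbT.
  apply/subsetP=> _ /imsetP[y Hy ->]; move: Hy; rewrite inE => /andP[Ky Hy].
  have [KT fT] := loop_morph_Tmap Kx Ky.
  by rewrite inE KT fT H2E gE memJ_conjg.
- by move=> P /sub_hall[H hallH sPH]; exists (loop_preim H); rewrite ?hall_preim.
Qed.

End LoopToGroup.

(** * Hall's theorem *)

Theorem theorem5p3 (Q : finLoopType) (pi : nat_pred)
    (hpi : forall p : nat, p \in pi -> prime p)
    (hextra : extra_loop Q) (hsol : solvable_loop Q) :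
  [/\ exists P : {set Q}, P \in Hall_subloops pi Q,
      forall P1 P2 : {set Q},
        P1 \in Hall_subloops pi Q -> P2 \in Hall_subloops pi Q ->
        exists x : Q, [set Tmap x y | y in P1] = P2
    & forall P : {set Q}, pi_subloop pi P ->
        exists2 H : {set Q}, H \in Hall_subloops pi Q & P \subset H].
Proof.
have slT := subloopT Q.
have ncN := nuclear_congruence_nucleus hextra.
have ncA := nuclear_congruence_central_involutions hextra.
have slN : subloop (nucleus Q).
  by apply: closed_subloop; [exact: nc1 ncN | exact: ncM ncN].
have RtrM : {in nucleus Q &, forall x y, Rtr (x * y) = (Rtr x * Rtr y)%g}.
  by move=> x y Nx Ny; apply/permP=> u; rewrite permM !RtrE nuc_m.
have Rtr1 x : (Rtr x == 1%g) = (x == 1).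
  apply/eqP/eqP=> [Rx | ->]; first by rewrite -[x]lmul1l -RtrE Rx perm1.
  by apply/permP=> u; rewrite RtrE perm1 lmull1.
have [pi2|pi'2] := boolP (2 \in pi).
  have fM : {in [set: Q] &, forall x y, coset_perm (central_involutions Q) (x * y)
    = (coset_perm (central_involutions Q) x * coset_perm (central_involutions Q) y)%g}.
    by move=> x y _ _; apply: coset_permM.
  apply: (Hall_transfer slT fM hsol) => [||P _]; rewrite ?cardsT ?subsetT //.
  have slA : subloop (central_involutions Q).
    by apply: closed_subloop; [exact: nc1 ncA | exact: ncM ncA].
  have -> : [set x in [set: Q] | coset_perm (central_involutions Q) x == 1%g]
     = central_involutions Q.
    by apply/setP=> x; rewrite !inE coset_perm_eq1 // !inE.
  (* right translations make A a permutation group of exponent dividing 2 *)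
  have sAN : central_involutions Q \subset nucleus Q by apply/subsetP; exact: nc_nuc ncA.
  have : 2.-nat #|@Rtr Q @: central_involutions Q|.
    apply: (sqr1_image slN RtrM slA sAN) => x /central_involutionsP[_ -> _].
    by apply/eqP; rewrite Rtr1.
  rewrite card_imset; first by apply: sub_in_pnat => p _ /eqnP->.
  by move=> x y /permP/(_ 1); rewrite !RtrE !lmul1l.
have fM : {in [set: Q] &, forall x y, coset_perm (nucleus Q) (x * y)
    = (coset_perm (nucleus Q) x * coset_perm (nucleus Q) y)%g}.
  by move=> x y _ _; apply: coset_permM.
have sqrN : {in [set: Q], forall x, coset_perm (nucleus Q) (x * x) = 1%g}.
  by move=> x _; apply/eqP; rewrite coset_perm_eq1 // sqr_nuc.
apply: (Hall_transfer slN RtrM hsol).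
- rewrite (_ : [set x in _ | _] = [set 1]) ?cards1 //.
  apply/setP=> x; apply/setIdP/set1P=> [[_]|->]; rewrite Rtr1; first by move/eqP.
  by split; first exact: nc1 ncN.
- rewrite -[in RHS]cardsT (card_subloop_image slT fM slT (subxx _)).
  have -> : [set x in [set: Q] | coset_perm (nucleus Q) x == 1%g] = nucleus Q.
    by apply/setP=> x; rewrite in_set coset_perm_eq1 // in_setT.
  have two := sqr1_image slT fM slT (subxx _) sqrN.
  have image_gt0 : (0 < #|[set coset_perm (nucleus Q) x | x in [set: Q]]|)%N.
    by case/andP: two.
  have N_gt0 : (0 < #|nucleus Q|)%N by apply/card_gt0P; exists 1; apply: nc1 ncN.
  rewrite partnM // [X in (X * _)%N]part_p'nat ?mul1n //.
  by apply: sub_in_pnat two => p _ /eqnP->.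
- move=> P /andP[slP piP]; apply/subsetP=> x Px.
  rewrite -(coset_perm_eq1 hextra ncN); apply/eqP.
  apply: (subloop_card_odd slT fM slP (subsetT P)) => //.
    by move=> y _; apply: sqrN.
  rewrite -[odd _]negbK -dvdn2; apply: contra pi'2 => even_P.
  have P_gt0 : (0 < #|P|)%N by case/andP: piP.
  by apply: (pnatPpi piP); rewrite mem_primes P_gt0.
Qed.
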